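(* Let $s\in(0,1]$, let $I\subset(0,\infty)$ be an interval, let $f:I\to\mathbb{R}$ be differentiable on $I^\circ$, let $a,b\in I$ with $a<b$, and suppose $f'\in L[a,b]$. Let $q>1$ and $\frac1p+\frac1q=1$. If $|f'|^q$ is harmonically $s$-convex on $[a,b]$, then for all $x\in[a,b]$, $$\left|f(x)-\frac{ab}{b-a}\int_a^b\frac{f(u)}{u^2}\,du\right|\le\frac{ab}{b-a}\left(\frac1{p+1}\right)^{\frac1p}\Big\{(x-a)^2\big(\lambda_1(a,x,s,q,0)|f'(x)|^q+\lambda_2(a,x,s,q,0)|f'(a)|^q\big)^{1/q}+(b-x)^2\big(\lambda_3(b,x,s,q,0)|f'(x)|^q+\lambda_4(b,x,s,q,0)|f'(b)|^q\big)^{1/q}\Big\}.$$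
   Context: For fixed $s\in(0,1]$ and a real interval $J\subset(0,\infty)$, a function $g:J\to\mathbb{R}$ is harmonically $s$-convex if $g\left(\frac{xy}{tx+(1-t)y}\right)\le t^s g(y)+(1-t)^s g(x)$ for all $x,y\in J$ and $t\in[0,1]$. $I^\circ$ is the interior of $I$; $L[a,b]$ denotes the Lebesgue integrable functions on $[a,b]$. Since $f'$ is used on all of $[a,b]$, $f$ is understood to be differentiable at every point of $[a,b]$ (one-sided at a point of $[a,b]$ that is an endpoint of $I$). The functions $\lambda_i$ are defined for $0<a\le x$ (for $\lambda_1,\lambda_2$) and $0<x\le b$ (for $\lambda_3,\lambda_4$) by $$\lambda_1(a,x,s,\vartheta,\rho)=\frac{\beta(\rho+s+1,1)}{x^{2\vartheta}}\,{}_2F_1\left(2\vartheta,\rho+s+1;\rho+s+2;1-\frac ax\right),$$ $$\lambda_2(a,x,s,\vartheta,\rho)=\frac{\beta(\rho+1,s+1)}{x^{2\vartheta}}\,{}_2F_1\left(2\vartheta,\rho+1;\rho+s+2;1-\frac ax\right),$$ $$\lambda_3(b,x,s,\vartheta,\rho)=\frac{\beta(1,\rho+s+1)}{b^{2\vartheta}}\,{}_2F_1\left(2\vartheta,1;\rho+s+2;1-\frac xb\right),$$ $$\lambda_4(b,x,s,\vartheta,\rho)=\frac{\beta(s+1,\rho+1)}{b^{2\vartheta}}\,{}_2F_1\left(2\vartheta,s+1;\rho+s+2;1-\frac xb\right).$$ Here $\beta(u,v)=\int_0^1t^{u-1}(1-t)^{v-1}\,dt$ for $u,v>0$ is the Euler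 Beta function, and ${}_2F_1(\alpha,\gamma;c;z)=\frac{1}{\beta(\gamma,c-\gamma)}\int_0^1t^{\gamma-1}(1-t)^{c-\gamma-1}(1-zt)^{-\alpha}\,dt$ for $c>\gamma>0$, $|z|<1$, is the hypergeometric function. *)

(* Defs.v *)
From HB Require Import structures.
From mathcomp Require Import all_boot all_order all_algebra.
From mathcomp Require Import all_classical all_reals all_analysis.

Set Implicit Arguments.
Unset Strict Implicit.
Unset Printing Implicit Defensive.

Import Order.TTheory GRing.Theory Num.Theory.
Import numFieldNormedType.Exports.

Local Open Scope classical_set_scope.
Local Open Scope ring_scope.

(* Functions I -> R are represented by total functions R -> R; all notions
   below depend only on their values on I. *)

(* Derivability and derivative at a relative to A: the difference quotient is
   restricted to increments h with h + a in A.  When A is an interval, this is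
   the ordinary derivative at an interior point (see derive1_within_interior)
   and the one-sided derivative at an endpoint belonging to A. *)
Definition derivable1_within (R : realType) (A : set R) (f : R -> R) (a : R) :
    Prop :=
  cvg (h^-1 * (f (h + a) - f a) @[h --> within [set h | A (h + a)] 0^']).

Definition derive1_within (R : realType) (A : set R) (f : R -> R) (a : R) : R :=
  lim (h^-1 * (f (h + a) - f a) @[h --> within [set h | A (h + a)] 0^']).

Lemma within_shift_interior (R : realType) (A : set R) (a : R) :
  A° a -> within [set h | A (h + a)] 0^' = 0^'.
Proof.
move=> Aa; rewrite eqEsubset; split => U; last exact: cvg_within.
have nA : \forall h \near (0 : R)^', A (h + a).
  apply: nbhs_dnbhs; have : h + a @[h --> (0 : R)] --> (0 + a : R).
    by apply: cvgD; [exact: cvg_id | exact: cvg_cst].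
  by rewrite add0r => /(_ A Aa).
by rewrite /within /= => UA; apply: filterS2 nA UA => h hA; exact.
Qed.

Lemma derivable1_within_interior (R : realType) (A : set R) (f : R -> R)
    (a : R) : A° a -> derivable1_within A f a <-> derivable f a 1.
Proof.
move=> Aa; rewrite /derivable1_within within_shift_interior// /derivable.
by under [X in _ <-> cvg (X @ _)]eq_fun do rewrite /GRing.scale /= mulr1.
Qed.

Lemma derive1_within_interior (R : realType) (A : set R) (f : R -> R) (a : R) :
  A° a -> derive1_within A f a = derive1 f a.
Proof. by move=> Aa; rewrite /derive1_within within_shift_interior. Qed.

Definition harmonically_s_convex (R : realType) (s : R) (J : set R)
    (g : R -> R) : Prop :=
  forall x y t : R, J x -> J y -> 0 <= t <= 1 ->
    g (x * y / (t * x + (1 - t) * y)) <= t `^ s * g y + (1 - t) `^ s * g x.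

(* Euler integrals, meaningful for u, v > 0 and for c > gamma > 0, |z| < 1.
   With a negative exponent powR is 0 at base 0, which only affects the
   integrand on the null set {0, 1}. *)
Definition Beta (R : realType) (u v : R) : R :=
  \int[lebesgue_measure]_(t in `[0, 1]) (t `^ (u - 1) * (1 - t) `^ (v - 1)).

Definition hyp2F1 (R : realType) (alpha gamma c z : R) : R :=
  (Beta gamma (c - gamma))^-1 *
  \int[lebesgue_measure]_(t in `[0, 1])
    (t `^ (gamma - 1) * (1 - t) `^ (c - gamma - 1) * (1 - z * t) `^ (- alpha)).

Definition lambda1 (R : realType) (a x s theta rho : R) : R :=
  Beta (rho + s + 1) 1 / x `^ (2 * theta) *
  hyp2F1 (2 * theta) (rho + s + 1) (rho + s + 2) (1 - a / x).

Definition lambda2 (R : realType) (a x s theta rho : R) : R :=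
  Beta (rho + 1) (s + 1) / x `^ (2 * theta) *
  hyp2F1 (2 * theta) (rho + 1) (rho + s + 2) (1 - a / x).

Definition lambda3 (R : realType) (b x s theta rho : R) : R :=
  Beta 1 (rho + s + 1) / b `^ (2 * theta) *
  hyp2F1 (2 * theta) 1 (rho + s + 2) (1 - x / b).

Definition lambda4 (R : realType) (b x s theta rho : R) : R :=
  Beta (s + 1) (rho + 1) / b `^ (2 * theta) *
  hyp2F1 (2 * theta) (s + 1) (rho + s + 2) (1 - x / b).

(* Main.v *)
(* Write v(t) = e x / (t e + (1 - t) x) for an endpoint e of [a, b], and let H
   be a primitive of u |-> (f x - f u) / u^2, so that the left-hand side is
   ab / (b - a) * |(H x - H a) - (H x - H b)|.  Each half H x - H e is, after
   the substitution u = v(t), an integral of f x - f (v t) over [0, 1].  Convexity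
   bounds the derivative of f o v pointwise by a continuous function beta, so
   |H x - H e| <= const * \int_0^1 t beta(t) dt follows by comparing derivatives
   (the fundamental theorem of calculus is never applied to f').  Hoelder's
   inequality then splits off \int_0^1 t^p = 1 / (p + 1), and \int_0^1 beta^q is
   a combination of two hypergeometric integrals. *)

Require Import Defs.
From HB Require Import structures.
From mathcomp Require Import all_boot all_order all_algebra.
From mathcomp Require Import all_classical all_reals all_analysis.
From mathcomp Require Import measurable_realfun.
From mathcomp Require Import ring lra.

Import Order.TTheory GRing.Theory Num.Theory.
Import numFieldNormedType.Exports.

Local Open Scope classical_set_scope.
Local Open Scope ring_scope.

(** * Comparison of increments, relative continuity and primitives *)

(** Both [G + F] and [G - F] have nonnegative derivatives on the open interval, so they are
    nondecreasing on the closed one. The two resulting inequalities bound the increment of [F] from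
    below and from above. *)
Lemma dominated_increment (R : realType) (F G dF dG : R -> R) (a b : R) :
  a <= b ->
  {within `[a, b], continuous F} -> {within `[a, b], continuous G} ->
  (forall t : R, t \in `]a, b[ -> is_derive t 1 F (dF t)) ->
  (forall t : R, t \in `]a, b[ -> is_derive t 1 G (dG t)) ->
  (forall t : R, t \in `]a, b[ -> `|dF t| <= dG t) ->
  `|F b - F a| <= G b - G a.
Proof.
move=> ab cF cG DF DG le_dF.
have mono (H dH : R -> R) : {within `[a, b], continuous H} ->
    (forall t : R, t \in `]a, b[ -> is_derive t 1 H (dH t)) ->
    (forall t : R, t \in `]a, b[ -> 0 <= dH t) -> H a <= H b.
  move=> cH DH H0; apply: (ger0_derive1_le_cc _ _ cH) => //.
  - by move=> t tab; have [] := DH t tab.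
  - by move=> t tab; rewrite derive1E; have [_ ->] := DH t tab; exact: H0.
  - by rewrite in_itv/= lexx.
  - by rewrite in_itv/= lexx andbT.
rewrite ler_norml; apply/andP; split.
  suff /= : (G + F) a <= (G + F) b by rewrite !fctE; lra.
  apply: (mono _ (dG + dF)).
  - exact: within_continuousD.
  - by move=> t tab; apply: is_deriveD; [exact: DG|exact: DF].
  - by move=> t /le_dF; rewrite !fctE ler_norml => /andP[]; lra.
suff /= : (G - F) a <= (G - F) b by rewrite !fctE; lra.
apply: (mono _ (dG - dF)).
- exact: within_continuousB.
- by move=> t tab; apply: is_deriveB; [exact: DG|exact: DF].
- by move=> t /le_dF; rewrite !fctE ler_norml => /andP[]; lra.
Qed.

Lemma continuous_itv_integrable (R : realType) (f : R -> R) (a b : R) :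
  {within `[a, b], continuous f} ->
  lebesgue_measure.-integrable `[a, b] (EFin \o f).
Proof. by apply: continuous_compact_integrable; exact: segment_compact. Qed.

Lemma within_continuousM (R : realType) (A : set R) (f g : R -> R) :
  {within A, continuous f} -> {within A, continuous g} ->
  {within A, continuous (fun t => f t * g t)}.
Proof. by move=> cf cg t; apply: cvgM; [exact: cf|exact: cg]. Qed.

(** At an endpoint of [[a, b]] the function [f] is only continuous from one side. Composition still
    works because [v] keeps its values in the segment. *)
Lemma within_continuous_comp_itv (R : realType) (A : set R) (f v : R -> R)
    (a b : R) : a <= b ->
  {within `[a, b], continuous f} -> {within A, continuous v} ->
  (forall t, A t -> v t \in `[a, b]) ->
  {within A, continuous (f \o v)}.
Proof.
move=> ab /subspace_continuousP cf /subspace_continuousP cv vab.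
apply/subspace_continuousP => t At.
move=> U /= fU.
have := cf (v t) (vab _ At) U fU.
move=> /(cv t At); rewrite /= /within/= !nbhs_simpl /= => h.
by near=> u => Au; apply: (near h u) => //; exact: vab.
Unshelve. all: by end_near. Qed.

Lemma primitive_continuous (R : realType) (f : R -> R) (a b : R) : a <= b ->
  {within `[a, b], continuous f} ->
  {within `[a, b], continuous
    (fun t => \int[lebesgue_measure]_(u in `[a, t]) f u)}.
Proof.
by move=> ab cf; apply: parameterized_integral_continuous => //;
  exact: continuous_itv_integrable.
Qed.

(** At an interior point, continuity relative to the segment is ordinary continuity, so the first
    fundamental theorem of calculus applies there. *)
Lemma primitive_is_derive (R : realType) (f : R -> R) (a b t : R) :
  {within `[a, b], continuous f} -> t \in `]a, b[ ->
  is_derive t 1 (fun t => \int[lebesgue_measure]_(u in `[a, t]) f u) (f t).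
Proof.
move=> cf tab; have /andP[at_ tb] : a < t < b by move: tab; rewrite in_itv.
have ct : {for t, continuous f}.
  exact: (within_continuous_continuous (lt_trans at_ tb) cf tab).
have [|d dE] := continuous_FTC1 tb (continuous_itv_integrable _ _ _ _ cf) _ ct.
  by rewrite lte_fin.
by split; [exact: d|rewrite -derive1E].
Qed.

(* With [B] a primitive of [beta], [t * (B 1 - B t) + \int_0^t u beta u] has
   derivative [B 1 - B t], which dominates [h 1 - h t] up to the factor [d]: an
   integration by parts that never integrates [dh]. *)
Lemma weighted_increment_bound (R : realType) (h dh beta K : R -> R) (c d : R) :
  {within `[0, 1], continuous h} -> {within `[0, 1], continuous K} ->
  {within `[0, 1], continuous beta} ->
  (forall t : R, t \in `]0, 1[ -> is_derive t 1 h (dh t)) ->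
  (forall t : R, t \in `]0, 1[ -> `|dh t| <= d * beta t) ->
  (forall t : R, t \in `]0, 1[ -> is_derive t 1 K (c * (h 1 - h t))) ->
  `|K 1 - K 0| <=
    `|c| * d * \int[lebesgue_measure]_(t in `[0, 1]) (t * beta t).
Proof.
move=> ch cK cbeta Dh le_dh DK.
pose B (t : R) := \int[lebesgue_measure]_(u in `[0, t]) beta u.
pose M (t : R) := \int[lebesgue_measure]_(u in `[0, t]) (u * beta u).
have cid : {within `[(0 : R), 1], continuous (fun t : R => t)}.
  by apply: continuous_subspaceT => t; exact: cvg_id.
have cM : {within `[0, 1], continuous (fun u : R => u * beta u)}.
  exact: within_continuousM.
have cB : {within `[0, 1], continuous B} by exact: primitive_continuous.
have cMi : {within `[0, 1], continuous M} by exact: primitive_continuous.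
have DB (t : R) : t \in `]0, 1[ -> is_derive t 1 B (beta t).
  exact: primitive_is_derive.
have DM (t : R) : t \in `]0, 1[ -> is_derive t 1 M (t * beta t).
  exact: primitive_is_derive cM.
have M0 : M 0 = 0 by rewrite /M set_itv1 Rintegral_set1.
rewrite -/(M 1); clearbody B M.
have le_h (t : R) : t \in `]0, 1[ -> `|h 1 - h t| <= d * (B 1 - B t).
  move=> t01; have /andP[t0 t1] : 0 < t < 1 by move: t01; rewrite in_itv.
  have sub : `[t, 1] `<=` `[0, 1]%classic.
    by apply: subset_itvr; rewrite bnd_simp ltW.
  have sub' (u : R) : u \in `]t, 1[ -> u \in `]0, 1[.
    by rewrite !in_itv/= => /andP[tu ->]; rewrite (lt_trans t0).
  have cdB : {within `[t, 1], continuous (fun u => d * B u)}.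
    apply: within_continuousM; last exact: continuous_subspaceW cB.
    by apply: continuous_subspaceT => u; exact: cvg_cst.
  have DdB (u : R) : u \in `]t, 1[ ->
      is_derive u 1 (fun u => d * B u) (d * beta u).
    by move=> /sub' /DB Bu; exact: is_deriveZ.
  have := dominated_increment R h (fun u => d * B u) dh (fun u => d * beta u)
    t 1 (ltW t1) (continuous_subspaceW sub ch) cdB
    (fun u tu => Dh u (sub' u tu)) DdB (fun u tu => le_dh u (sub' u tu)).
  by rewrite mulrBr.
have cP : {within `[0, 1], continuous (fun t : R => t * (B 1 - B t))}.
  apply: within_continuousM => // u; apply: cvgB; last exact: cB.
  exact: cvg_cst.
pose Psi (t : R) : R := `|c| * d * (t * (B 1 - B t) + M t).
(* The boundary term [t * (B 1 - B t)] vanishes at both [0] and [1]. *)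
have -> : `|c| * d * M 1 = Psi 1 - Psi 0.
  rewrite /Psi M0; ring.
apply: (@dominated_increment R K Psi (fun t => c * (h 1 - h t))
  (fun t => `|c| * d * (B 1 - B t)) 0 1).
- exact: ler01.
- exact: cK.
- apply: within_continuousM.
    by apply: continuous_subspaceT => u; exact: cvg_cst.
  by move=> t; apply: cvgD; [exact: cP|exact: cMi].
- move=> t t01; have DBt := DB t t01; have DMt := DM t t01.
  have -> : Psi = (`|c| * d) \*: (id * (cst (B 1) - B) + M) by [].
  apply: is_derive_eq; rewrite !fctE /GRing.scale /=; ring.
- move=> t t01; rewrite normrM -mulrA ler_wpM2l//; exact: le_h.
Qed.

(** * Real powers, their integrals and Hoelder's inequality *)

(** The absolute value yields a function continuous on the whole line that agrees with the power on
    nonnegative bases, so it can be composed freely. Away from [0] continuity comes from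
    differentiability of the power. *)
Lemma continuous_normr_powR (R : realType) (r : R) : 0 < r ->
  continuous (fun t : R => `|t| `^ r).
Proof.
move=> r0 t; have [->|t0] := eqVneq t 0.
  suff : `|u| `^ r @[u --> (0 : R)] --> (0 : R).
    by rewrite /continuous_at normr0 powR0 ?gt_eqF.
  apply/cvgrPdist_lt => e e0.
  have d0 : 0 < e `^ r^-1 by rewrite powR_gt0.
  have := @nbhs0_lt R R _ d0; apply: filterS => u ud.
  rewrite sub0r normrN ger0_norm ?powR_ge0//.
  have -> : e = (e `^ r^-1) `^ r by rewrite -powRrM mulVf ?gt_eqF// powRr1// ltW.
  by apply: gt0_ltr_powR; rewrite ?nnegrE ?normr_ge0 ?(ltW d0).
have ct : {for t, continuous (fun t : R => `|t|)} by exact: norm_continuous.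
have cp : {for `|t|, continuous (fun t : R => t `^ r)}.
  apply/differentiable_continuous/derivable1_diffP/derivable_powR.
  by rewrite in_itv/= andbT normr_gt0.
exact: (continuous_comp ct cp).
Qed.

Lemma within_continuous_powR (R : realType) (A : set R) (g : R -> R) (r : R) :
  0 < r -> (forall t, A t -> 0 <= g t) -> {within A, continuous g} ->
  {within A, continuous (fun t => g t `^ r)}.
Proof.
move=> r0 g0 cg.
apply: (@subspace_eq_continuous R A R ((fun t : R => `|t| `^ r) \o g)).
  by move=> t /[!inE] At /=; rewrite ger0_norm ?g0.
apply: within_continuous_comp cg => t _; exact: continuous_normr_powR.
Qed.

(** Strict positivity of the base admits exponents of any sign; negative ones occur in the
    hypergeometric kernel. *)
Lemma within_continuous_gt0_powR (R : realType) (A : set R) (g : R -> R)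
    (r : R) :
  (forall t, A t -> 0 < g t) -> {within A, continuous g} ->
  {within A, continuous (fun t => g t `^ r)}.
Proof.
move=> g0 cg.
suff : {in g @` A, continuous (fun t : R => t `^ r)}.
  move=> cp; exact: (within_continuous_comp A g (fun t : R => t `^ r) cp cg).
move=> u.
rewrite inE => -[t At <-].
apply/differentiable_continuous/derivable1_diffP/derivable_powR.
by rewrite in_itv/= andbT g0.
Qed.

Lemma Rintegral_FTC2 (R : realType) (f F : R -> R) (a b : R) : a < b ->
  {within `[a, b], continuous f} -> {within `[a, b], continuous F} ->
  (forall t : R, t \in `]a, b[ -> is_derive t 1 F (f t)) ->
  \int[lebesgue_measure]_(t in `[a, b]) f t = F b - F a.
Proof.
move=> ab cf cF DF; rewrite /Rintegral (@continuous_FTC2 R f F a b ab cf)//.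
- have /continuous_within_itvP-/(_ ab)[_ ca cb] := cF.
  by split=> // t /DF [].
- by move=> t /DF[_ <-]; rewrite derive1E.
Qed.

Lemma Rintegral_powR (R : realType) (r : R) : 0 < r ->
  \int[lebesgue_measure]_(t in `[(0 : R), 1]) (t `^ r) = (r + 1)^-1.
Proof.
move=> r0; have r10 : r + 1 != 0 by rewrite gt_eqF// addr_gt0.
have cpow (u : R) : 0 < u -> {within `[(0 : R), 1], continuous (fun t : R => t `^ u)}.
  move=> u0; apply: (within_continuous_powR R `[0, 1] id u u0).
    by move=> t /=; rewrite in_itv/= => /andP[].
  by apply: continuous_subspaceT => t; exact: cvg_id.
pose F (t : R) := (r + 1)^-1 * t `^ (r + 1).
have -> : (r + 1)^-1 = F 1 - F 0.
  by rewrite /F powR1 powR0// mulr0 subr0 mulr1.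
apply: Rintegral_FTC2.
- exact: ltr01.
- exact: cpow.
- apply: within_continuousM; last by apply: cpow; lra.
  by apply: continuous_subspaceT => u; exact: cvg_cst.
- move=> t; rewrite in_itv/= => /andP[t0 _].
  have := is_deriveZ (r + 1)^-1 (is_derive1_powR (r + 1) t0).
  by rewrite /GRing.scale/= mulrA mulVf// mul1r addrK.
Qed.

(** Turns the extended-real norm of an extension by zero, as it occurs in Hoelder's inequality on
    the whole space, into a real integral over [A]. *)
Lemma Lnorm_restrict d (T : measurableType d) (R : realType)
    (mu : {measure set T -> \bar R}) (A : set T) (f : T -> R) (p : R) :
  measurable A -> 0 < p -> (forall t, A t -> 0 <= f t) ->
  mu.-integrable A (EFin \o (fun t => f t `^ p)) ->
  'N[mu]_p%:E [EFin \o (f \_ A)]%E =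
    ((\int[mu]_(t in A) (f t `^ p)) `^ p^-1)%:E.
Proof.
move=> mA p0 f0 intf; rewrite unlock -poweR_EFin; congr (_ `^ _)%E.
rewrite /Rintegral fineK; last exact: integrable_fin_num.
rewrite [RHS]integral_mkcond; apply: eq_integral => t _.
rewrite /= !patchE; case: ifPn => [|_].
  by rewrite inE => At; rewrite ger0_norm ?f0.
by rewrite normr0 powR0// gt_eqF.
Qed.

(** Hoelder's inequality on the whole line is applied to the extensions of [f] and [g] by zero;
    continuity on the segment provides measurability and finite integrals. *)
Lemma hoelder_itv (R : realType) (f g : R -> R) (a b p q : R) :
  0 < p -> 0 < q -> p^-1 + q^-1 = 1 ->
  {within `[a, b], continuous f} -> {within `[a, b], continuous g} ->
  (forall t, t \in `[a, b] -> 0 <= f t) ->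
  (forall t, t \in `[a, b] -> 0 <= g t) ->
  \int[lebesgue_measure]_(t in `[a, b]) (f t * g t) <=
    (\int[lebesgue_measure]_(t in `[a, b]) (f t `^ p)) `^ p^-1 *
    (\int[lebesgue_measure]_(t in `[a, b]) (g t `^ q)) `^ q^-1.
Proof.
move=> p0 q0 pq cf cg f0 g0.
have mab : measurable (`[a, b] : set R) by exact: measurable_itv.
have mpatch (h : R -> R) : {within `[a, b], continuous h} ->
    measurable_fun [set: R] (h \_ `[a, b]).
  move=> ch; apply/(measurable_restrictT _ mab).
  exact: subspace_continuous_measurable_fun.
have := hoelder lebesgue_measure (mpatch f cf) (mpatch g cg) p0 q0 pq.
rewrite !Lnorm_restrict//; last 2 first.
- by apply: continuous_itv_integrable; exact: within_continuous_powR.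
- by apply: continuous_itv_integrable; exact: within_continuous_powR.
rewrite -EFinM.
suff -> : 'N[lebesgue_measure]_1 [EFin \o (f \_ `[a, b] \* g \_ `[a, b])%R]%E =
    (\int[lebesgue_measure]_(t in `[a, b]) (f t * g t))%:E by rewrite lee_fin.
rewrite Lnorm1 /Rintegral fineK; last first.
  by apply: integrable_fin_num => //; apply: continuous_itv_integrable;
    exact: within_continuousM.
rewrite [RHS]integral_mkcond; apply: eq_integral => t _.
rewrite /= !patchE; case: ifPn => [|_]; last by rewrite mul0r normr0.
by rewrite inE /= => tab; rewrite ger0_norm// mulr_ge0// ?f0 ?g0.
Qed.

(** * The hypergeometric coefficients as weight integrals *)

Lemma Rintegral_onem (R : realType) (G : R -> R) :
  {within `[0, 1], continuous G} ->
  \int[lebesgue_measure]_(t in `[0, 1]) G t =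
  \int[lebesgue_measure]_(t in `[0, 1]) G (1 - t).
Proof.
move=> cG; rewrite Rintegration_by_substitution_onem ?lexx ?ler01//.
by rewrite /unstable.onem subrr.
Qed.

(* Weights of |f'(x)|^q and |f'(e)|^q: with r = 2 q these are lambda1 and
   lambda2 for e = a, and lambda3 and lambda4 for e = b; the latter pair needs
   the reflection t -> 1 - t. *)
Definition weight1 {R : realType} (e x s r : R) : R :=
  \int[lebesgue_measure]_(t in `[0, 1])
    (t `^ s * (t * e + (1 - t) * x) `^ (- r)).

Definition weight2 {R : realType} (e x s r : R) : R :=
  \int[lebesgue_measure]_(t in `[0, 1])
    ((1 - t) `^ s * (t * e + (1 - t) * x) `^ (- r)).

Lemma combination_gt0 (R : realType) (e x t : R) : 0 < e -> 0 < x ->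
  0 <= t <= 1 -> 0 < t * e + (1 - t) * x.
Proof. by move=> e0 x0 /andP[t0 t1]; nra. Qed.

Lemma continuous_combination (R : realType) (A : set R) (e x : R) :
  {within A, continuous (fun t : R => t * e + (1 - t) * x)}.
Proof.
apply: continuous_subspaceT => t; apply: cvgD; apply: cvgMl.
  exact: cvg_id.
by apply: cvgB; [exact: cvg_cst|exact: cvg_id].
Qed.

Lemma continuous_combination_powR (R : realType) (e x r : R) :
  0 < e -> 0 < x ->
  {within `[0, 1], continuous (fun t : R => (t * e + (1 - t) * x) `^ r)}.
Proof.
move=> e0 x0; apply: within_continuous_gt0_powR; last first.
  exact: continuous_combination.
by move=> t /=; rewrite in_itv/=; exact: combination_gt0.
Qed.

Lemma continuous_powR01 (R : realType) (s : R) : 0 < s ->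
  {within `[0, 1], continuous (fun t : R => t `^ s)}.
Proof.
move=> s0; apply: (within_continuous_powR _ _ id) => //.
  by move=> t /=; rewrite in_itv/= => /andP[].
by apply: continuous_subspaceT => t; exact: cvg_id.
Qed.

Lemma continuous_onem_powR01 (R : realType) (s : R) : 0 < s ->
  {within `[0, 1], continuous (fun t : R => (1 - t) `^ s)}.
Proof.
move=> s0; apply: within_continuous_powR => //.
  by move=> t /=; rewrite in_itv/= subr_ge0 => /andP[].
by apply: continuous_subspaceT => t; apply: cvgB; [exact: cvg_cst|exact: cvg_id].
Qed.

Lemma weight1_continuous (R : realType) (e x s r : R) :
  0 < e -> 0 < x -> 0 < s -> {within `[0, 1], continuous
    (fun t : R => t `^ s * (t * e + (1 - t) * x) `^ (- r))}.
Proof.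
move=> e0 x0 s0; apply: within_continuousM; first exact: continuous_powR01.
exact: continuous_combination_powR.
Qed.

Lemma weight2_continuous (R : realType) (e x s r : R) :
  0 < e -> 0 < x -> 0 < s -> {within `[0, 1], continuous
    (fun t : R => (1 - t) `^ s * (t * e + (1 - t) * x) `^ (- r))}.
Proof.
move=> e0 x0 s0; apply: within_continuousM; first exact: continuous_onem_powR01.
exact: continuous_combination_powR.
Qed.

(** The reflection [t -> 1 - t] swaps the roles of the two points. *)
Lemma weight12_sym (R : realType) (e x s r : R) :
  0 < e -> 0 < x -> 0 < s -> weight1 e x s r = weight2 x e s r.
Proof.
move=> e0 x0 s0; rewrite /weight1 Rintegral_onem; last exact: weight1_continuous.
by apply: eq_Rintegral => t _; congr (_ * _ `^ _); ring.
Qed.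

Lemma Beta_r1 (R : realType) (s : R) : 0 < s -> Beta (s + 1) 1 = (s + 1)^-1.
Proof.
move=> s0; rewrite -Rintegral_powR//; apply: eq_Rintegral => t _.
by rewrite addrK subrr powRr0 mulr1.
Qed.

Lemma Beta_1r (R : realType) (s : R) : 0 < s -> Beta 1 (s + 1) = (s + 1)^-1.
Proof.
move=> s0; rewrite -Rintegral_powR// Rintegral_onem; last exact: continuous_powR01.
by apply: eq_Rintegral => t _; rewrite addrK subrr powRr0 mul1r.
Qed.

Lemma combination_scale (R : realType) (e x r t : R) : 0 < e -> 0 < x ->
  0 <= t <= 1 ->
  (1 - (1 - e / x) * t) `^ (- r) = x `^ r * (t * e + (1 - t) * x) `^ (- r).
Proof.
move=> e0 x0 t01; have m0 := combination_gt0 R e x t e0 x0 t01.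
have -> : 1 - (1 - e / x) * t = (t * e + (1 - t) * x) / x.
  by field; rewrite gt_eqF.
rewrite powRM ?invr_ge0 ?(ltW m0) ?(ltW x0)// mulrC; congr (_ * _).
by rewrite -(powR_inv1 (ltW x0)) -powRrM mulrNN mul1r.
Qed.

(** Here [c - gamma = 1], so the power of [1 - t] has exponent [0] and equals [1], even at [t = 1].
    The outer Beta factor cancels the normalisation inside [hyp2F1]. *)
Lemma hyp2F1_weight1 (R : realType) (e x s r : R) :
  0 < e -> 0 < x -> 0 < s ->
  Beta (s + 1) 1 / x `^ r * hyp2F1 r (s + 1) (s + 2) (1 - e / x) =
    weight1 e x s r.
Proof.
move=> e0 x0 s0; rewrite /hyp2F1 (_ : s + 2 - (s + 1) = 1); last by ring.
have -> : \int[lebesgue_measure]_(t in `[0, 1])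
    (t `^ (s + 1 - 1) * (1 - t) `^ (1 - 1) * (1 - (1 - e / x) * t) `^ (- r)) =
    x `^ r * weight1 e x s r.
  rewrite -RintegralZl//; last by apply/continuous_itv_integrable/weight1_continuous.
  apply: eq_Rintegral => t /[!inE]/=; rewrite in_itv/= => t01.
  by rewrite combination_scale// addrK subrr powRr0 mulr1 mulrCA.
rewrite Beta_r1//; field.
by rewrite !gt_eqF// ?powR_gt0// addr_gt0.
Qed.

Lemma hyp2F1_weight2 (R : realType) (e x s r : R) :
  0 < e -> 0 < x -> 0 < s ->
  Beta 1 (s + 1) / x `^ r * hyp2F1 r 1 (s + 2) (1 - e / x) =
    weight2 e x s r.
Proof.
move=> e0 x0 s0; rewrite /hyp2F1 (_ : s + 2 - 1 = s + 1); last by ring.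
have -> : \int[lebesgue_measure]_(t in `[0, 1])
    (t `^ (1 - 1) * (1 - t) `^ (s + 1 - 1) * (1 - (1 - e / x) * t) `^ (- r)) =
    x `^ r * weight2 e x s r.
  rewrite -RintegralZl//; last by apply/continuous_itv_integrable/weight2_continuous.
  apply: eq_Rintegral => t /[!inE]/=; rewrite in_itv/= => t01.
  by rewrite combination_scale// addrK subrr powRr0 mul1r mulrCA.
rewrite Beta_1r//; field.
by rewrite !gt_eqF// ?powR_gt0// addr_gt0.
Qed.

Lemma lambda1E (R : realType) (a x s q : R) : 0 < a -> 0 < x -> 0 < s ->
  lambda1 a x s q 0 = weight1 a x s (2 * q).
Proof. by move=> *; rewrite /lambda1 !add0r hyp2F1_weight1. Qed.

Lemma lambda2E (R : realType) (a x s q : R) : 0 < a -> 0 < x -> 0 < s ->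
  lambda2 a x s q 0 = weight2 a x s (2 * q).
Proof. by move=> *; rewrite /lambda2 !add0r hyp2F1_weight2. Qed.

Lemma lambda3E (R : realType) (b x s q : R) : 0 < b -> 0 < x -> 0 < s ->
  lambda3 b x s q 0 = weight1 b x s (2 * q).
Proof.
move=> b0 x0 s0; rewrite /lambda3 !add0r (hyp2F1_weight2 R x b s _ x0 b0 s0).
by rewrite (weight12_sym R b x).
Qed.

Lemma lambda4E (R : realType) (b x s q : R) : 0 < b -> 0 < x -> 0 < s ->
  lambda4 b x s q 0 = weight2 b x s (2 * q).
Proof.
move=> b0 x0 s0; rewrite /lambda4 !add0r (hyp2F1_weight1 R x b s _ x0 b0 s0).
by rewrite (weight12_sym R x b).
Qed.

(** * Weighted harmonic means of two points *)

(** With [m = t * e + (1 - t) * x], one has [e * x - a * m = t * e * (x - a) + (1 - t) * x * (e -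
    a)] and [b * m - e * x = t * e * (b - x) + (1 - t) * x * (b - e)]; all four terms are
    nonnegative. *)
Lemma harmonic_mean_itv (R : realType) (a b e x t : R) : 0 < a ->
  e \in `[a, b] -> x \in `[a, b] -> t \in `[0, 1] ->
  e * x / (t * e + (1 - t) * x) \in `[a, b].
Proof.
rewrite !in_itv/= => a0 /andP[ae eb] /andP[ax xb] t01.
have e0 := lt_le_trans a0 ae; have x0 := lt_le_trans a0 ax.
have m0 := combination_gt0 R e x t e0 x0 t01.
have /andP[t0 t1] := t01; have t1' : 0 <= 1 - t by rewrite subr_ge0.
rewrite ler_pdivlMr// ler_pdivrMr//.
have h1 := mulr_ge0 t0 (mulr_ge0 (ltW e0) (eqbRL (subr_ge0 a x) ax)).
have h2 := mulr_ge0 t1' (mulr_ge0 (ltW x0) (eqbRL (subr_ge0 a e) ae)).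
have h3 := mulr_ge0 t0 (mulr_ge0 (ltW e0) (eqbRL (subr_ge0 x b) xb)).
have h4 := mulr_ge0 t1' (mulr_ge0 (ltW x0) (eqbRL (subr_ge0 e b) eb)).
by apply/andP; split; lra.
Qed.

Lemma harmonic_mean_itv_oo (R : realType) (a b e x t : R) : 0 < a ->
  e \in `[a, b] -> x \in `[a, b] -> e != x -> t \in `]0, 1[ ->
  e * x / (t * e + (1 - t) * x) \in `]a, b[.
Proof.
rewrite !in_itv/= => a0 /andP[ae eb] /andP[ax xb] ex /andP[t0 t1].
have e0 := lt_le_trans a0 ae; have x0 := lt_le_trans a0 ax.
have m0 : 0 < t * e + (1 - t) * x.
  by apply: combination_gt0 => //; rewrite !ltW.
have t1' : 0 < 1 - t by rewrite subr_gt0.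
have te := mulr_gt0 t0 e0; have tx := mulr_gt0 t1' x0.
rewrite ltr_pdivlMr// ltr_pdivrMr//.
have h1 := mulr_ge0 (ltW te) (eqbRL (subr_ge0 a x) ax).
have h2 := mulr_ge0 (ltW tx) (eqbRL (subr_ge0 a e) ae).
have h3 := mulr_ge0 (ltW te) (eqbRL (subr_ge0 x b) xb).
have h4 := mulr_ge0 (ltW tx) (eqbRL (subr_ge0 e b) eb).
(* The larger of the two points exceeds [a] and the smaller is below [b], which makes one term
   strictly positive in each of the two decompositions. *)
case: (ltgtP e x) ex => // [ltex|ltxe] _.
  have h5 := mulr_gt0 te (eqbRL (subr_gt0 a x) (le_lt_trans ae ltex)).
  have h6 := mulr_gt0 tx (eqbRL (subr_gt0 e b) (lt_le_trans ltex xb)).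
  by apply/andP; split; lra.
have h5 := mulr_gt0 tx (eqbRL (subr_gt0 a e) (le_lt_trans ax ltxe)).
have h6 := mulr_gt0 te (eqbRL (subr_gt0 x b) (lt_le_trans ltxe eb)).
by apply/andP; split; lra.
Qed.

Lemma is_derive_harmonic_mean (R : realType) (e x t : R) : 0 < e -> 0 < x ->
  0 <= t <= 1 ->
  is_derive t 1 (fun t : R => e * x / (t * e + (1 - t) * x))
    (e * x * (x - e) / (t * e + (1 - t) * x) ^+ 2).
Proof.
move=> e0 x0 t01; have m0 := combination_gt0 R e x t e0 x0 t01.
have Dm : is_derive t 1 (fun t : R => t * e + (1 - t) * x) (e - x).
  have -> : (fun t : R => t * e + (1 - t) * x) =
      (e - x) \*: (id : R -> R) + cst x.
    apply/funext => u; rewrite !fctE.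
    by change (u * e + (1 - u) * x = (e - x) * u + x); ring.
  by apply: is_derive_eq; rewrite /GRing.scale/=; ring.
have := is_deriveZ (e * x)
  (@is_deriveV R (fun t : R => t * e + (1 - t) * x) _ _ _ (lt0r_neq0 m0) Dm).
move=> D; apply: (is_derive_eq D); rewrite /GRing.scale/=; field.
by rewrite gt_eqF.
Qed.

(** * The estimate for one half *)

(** Serves [e = a] and [e = b] alike, since the sign of [x - e] is left free. The condition [e != x]
    keeps the path from [e] to [x] inside the open interval for [0 < t < 1], where [f] and [H] have
    derivatives. *)
Lemma half_bound (R : realType) (f df H : R -> R) (a b e x s p q : R) :
  0 < a -> a < b -> e \in `[a, b] -> x \in `[a, b] -> e != x ->
  0 < s -> 0 < p -> 0 < q -> p^-1 + q^-1 = 1 ->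
  {within `[a, b], continuous f} -> {within `[a, b], continuous H} ->
  (forall u : R, u \in `]a, b[ -> is_derive u 1 f (df u)) ->
  (forall u : R, u \in `]a, b[ -> is_derive u 1 H ((f x - f u) / u ^+ 2)) ->
  (forall t : R, t \in `]0, 1[ ->
    `|df (e * x / (t * e + (1 - t) * x))| `^ q <=
      t `^ s * `|df x| `^ q + (1 - t) `^ s * `|df e| `^ q) ->
  `|H x - H e| <= (x - e) ^+ 2 * ((p + 1)^-1 `^ p^-1 *
    (weight1 e x s (2 * q) * `|df x| `^ q +
     weight2 e x s (2 * q) * `|df e| `^ q) `^ q^-1).
Proof.
move=> a0 ab eab xab ex s0 p0 q0 pq cf cH Df DH cvx.
have e0 : 0 < e by move: eab; rewrite in_itv/= => /andP[/(lt_le_trans a0)].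
have x0 : 0 < x by move: xab; rewrite in_itv/= => /andP[/(lt_le_trans a0)].
have sub (t : R) : t \in `]0, 1[ -> 0 <= t <= 1.
  by rewrite in_itv/= => /andP[/ltW-> /ltW->].
pose m (t : R) := t * e + (1 - t) * x.
have m_gt0 (t : R) : 0 <= t <= 1 -> 0 < m t by exact: combination_gt0.
pose v (t : R) := e * x / m t.
pose G (t : R) := t `^ s * `|df x| `^ q + (1 - t) `^ s * `|df e| `^ q.
pose beta (t : R) := G t `^ q^-1 * m t `^ (- 2).
have G_ge0 (t : R) : 0 <= G t.
  by rewrite addr_ge0// mulr_ge0// powR_ge0.
have v1 : v 1 = x by rewrite /v /m; field; rewrite gt_eqF.
have v0 : v 0 = e by rewrite /v /m; field; rewrite gt_eqF.
have m2 (t : R) : 0 <= t <= 1 -> m t `^ (- 2) = (m t ^+ 2)^-1.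
  by move=> t01; rewrite powRN powR_mulrn// ltW// m_gt0.
have Dv (t : R) : 0 <= t <= 1 ->
    is_derive t 1 v (e * x * (x - e) / m t ^+ 2).
  exact: is_derive_harmonic_mean.
have cv : {within `[0, 1], continuous v}.
  by apply: derivable_within_continuous => t; rewrite in_itv/= => /Dv[].
have vab (t : R) : `[0, 1]%classic t -> v t \in `[a, b].
  by move=> /=; exact: harmonic_mean_itv.
have vab' (t : R) : t \in `]0, 1[ -> v t \in `]a, b[.
  exact: harmonic_mean_itv_oo.
have cG : {within `[0, 1], continuous G}.
  have cc (k : R) : {within `[(0 : R), 1], continuous (fun _ : R => k)}.
    by apply: continuous_subspaceT => t; exact: cvg_cst.
  have c1 := within_continuousM _ _ _ _ (continuous_powR01 R s s0)
    (cc (`|df x| `^ q)).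
  have c2 := within_continuousM _ _ _ _ (continuous_onem_powR01 R s s0)
    (cc (`|df e| `^ q)).
  exact: (within_continuousD c1 c2).
have cbeta : {within `[0, 1], continuous beta}.
  apply: within_continuousM; last exact: continuous_combination_powR.
  by apply: within_continuous_powR => //; rewrite invr_gt0.
have ch : {within `[0, 1], continuous (f \o v)}.
  exact: (within_continuous_comp_itv _ _ _ _ _ _ (ltW ab) cf cv vab).
have cK : {within `[0, 1], continuous (H \o v)}.
  exact: (within_continuous_comp_itv _ _ _ _ _ _ (ltW ab) cH cv vab).
have Dh (t : R) : t \in `]0, 1[ ->
    is_derive t 1 (f \o v) (df (v t) * (e * x * (x - e) / m t ^+ 2)).
  by move=> t01; exact: (is_derive1_comp (Df _ (vab' _ t01)) (Dv _ (sub _ t01))).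
have le_dh (t : R) : t \in `]0, 1[ ->
    `|df (v t) * (e * x * (x - e) / m t ^+ 2)| <= `|x - e| * (e * x) * beta t.
  move=> t01; have mt := m_gt0 _ (sub _ t01).
  have dfG : `|df (v t)| <= G t `^ q^-1.
    rewrite -[leLHS]powRr1// -(@mulfV _ q) ?gt_eqF// powRrM.
    apply: ge0_ler_powR; rewrite ?nnegrE ?powR_ge0 ?invr_ge0 ?(ltW q0)//.
    exact: cvx.
  have -> : `|df (v t) * (e * x * (x - e) / m t ^+ 2)| =
      `|x - e| * (e * x) * (`|df (v t)| * m t `^ (- 2)).
    rewrite m2 ?sub// !normrM normfV (ger0_norm (exprn_ge0 _ (ltW mt))).
    rewrite (gtr0_norm e0) (gtr0_norm x0); ring.
  rewrite ler_wpM2l ?mulr_ge0 ?(ltW e0) ?(ltW x0)//.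
  by rewrite ler_wpM2r ?powR_ge0.
(* The factor is constant in [t] because [m t] cancels in the quotient of the derivative of [v] by
   [v t ^+ 2], leaving [(x - e) / (e * x)]. *)
have DK (t : R) : t \in `]0, 1[ -> is_derive t 1 (H \o v)
    ((x - e) / (e * x) * ((f \o v) 1 - (f \o v) t)).
  move=> t01; have mt := m_gt0 _ (sub _ t01).
  have D := is_derive1_comp (DH _ (vab' _ t01)) (Dv _ (sub _ t01)).
  apply: (is_derive_eq D); rewrite /comp v1 /v; field.
  by rewrite !gt_eqF.
have : `|H x - H e| <= (x - e) ^+ 2 *
    \int[lebesgue_measure]_(t in `[0, 1]) (t * beta t).
  (* One factor [|x - e|] comes from the derivative of [H \o v], the other from that of [f \o v];
     the factors [e * x] cancel. *)
  have -> : (x - e) ^+ 2 = `|(x - e) / (e * x)| * (`|x - e| * (e * x)).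
    rewrite -real_normK ?num_real// normrM normfV.
    rewrite (ger0_norm (ltW (mulr_gt0 e0 x0))); field.
    by rewrite !gt_eqF.
  have := weighted_increment_bound R _ _ _ _ _ _ ch cK cbeta Dh le_dh DK.
  by rewrite {1 2}/comp v1 v0.
move=> /le_trans; apply; rewrite ler_wpM2l ?sqr_ge0//.
have cid : {within `[(0 : R), 1], continuous (fun t : R => t)}.
  by apply: continuous_subspaceT => t; exact: cvg_id.
have := hoelder_itv R (fun t => t) beta 0 1 p q p0 q0 pq cid cbeta.
rewrite Rintegral_powR//.
have -> : \int[lebesgue_measure]_(t in `[0, 1]) (beta t `^ q) =
    weight1 e x s (2 * q) * `|df x| `^ q +
    weight2 e x s (2 * q) * `|df e| `^ q.
  pose w1 (t : R) := t `^ s * m t `^ (- (2 * q)).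
  pose w2 (t : R) := (1 - t) `^ s * m t `^ (- (2 * q)).
  have c1 : {within `[0, 1], continuous w1} by exact: weight1_continuous.
  have c2 : {within `[0, 1], continuous w2} by exact: weight2_continuous.
  have cZ (w : R -> R) (k : R) : {within `[0, 1], continuous w} ->
      {within `[0, 1], continuous (fun t => w t * k)}.
    move=> cw; apply: within_continuousM => //.
    by apply: continuous_subspaceT => t; exact: cvg_cst.
  have mI : measurable (`[0, 1] : set R) by exact: measurable_itv.
  have eZ (w : R -> R) (k : R) : {within `[0, 1], continuous w} ->
      \int[lebesgue_measure]_(t in `[0, 1]) w t * k =
      \int[lebesgue_measure]_(t in `[0, 1]) (w t * k).
    by move=> cw; rewrite RintegralZr//; exact: continuous_itv_integrable.
  transitivity (\int[lebesgue_measure]_(t in `[0, 1])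
      (w1 t * `|df x| `^ q + w2 t * `|df e| `^ q)); last first.
    rewrite RintegralD//; last 2 first.
    - exact/continuous_itv_integrable/cZ.
    - exact/continuous_itv_integrable/cZ.
    by rewrite -(eZ _ _ c1) -(eZ _ _ c2).
  (* Raising [beta] to the power [q] undoes the root of [G] and turns the exponent [- 2] into
     [- (2 * q)]. *)
  apply: eq_Rintegral => t; rewrite inE/= in_itv/= => t01.
  rewrite /beta powRM ?powR_ge0// -!powRrM mulVf ?gt_eqF// powRr1// mulNr.
  by rewrite /G mulrDl mulrAC [X in _ + X]mulrAC.
apply.
- by move=> t; rewrite in_itv/= => /andP[].
- by move=> t _; rewrite mulr_ge0 ?powR_ge0.
Qed.

(** * Relative derivability and assembly of the two halves *)

(** The increment of [f] is [h] times a convergent difference quotient, and [h] tends to [0]. *)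
Lemma derivable1_within_continuous (R : realType) (A : set R) (f : R -> R)
    (u : R) :
  derivable1_within A f u -> f y @[y --> within A (nbhs u)] --> f u.
Proof.
rewrite /derivable1_within; set W := within _ _ => /cvg_ex[l Wl].
have idW : h @[h --> W] --> (0 : R).
  apply: cvg_trans (cvg_within _) _; exact: nbhs_dnbhs.
have : h * (h^-1 * (f (h + u) - f u)) + f u @[h --> W] --> 0 * l + f u.
  by apply: cvgD; [exact: cvgM|exact: cvg_cst].
rewrite mul0r add0r => fW U fU.
have : \forall h \near (0 : R), h != 0 -> A (h + u) ->
    U (h * (h^-1 * (f (h + u) - f u)) + f u) by exact: (fW U fU).
have shift : y - u @[y --> u] --> (0 : R).
  by rewrite -(subrr u); apply: cvgB; [exact: cvg_id|exact: cvg_cst].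
move=> /shift; rewrite /= /within/= !nbhs_simpl/=.
apply: filterS => y /=; rewrite subrK subr_eq0 => Uy Ay.
(* The difference quotient lives on a punctured neighbourhood, so the point [y = u] is handled
   apart. *)
have [->|yu] := eqVneq y u; first exact: nbhs_singleton.
by have := Uy yu Ay; rewrite mulrA mulfV ?subr_eq0// mul1r subrK.
Qed.

(** The value is [(b - a) / (a * b)], the inverse of the prefactor in the theorem, so [f x] itself
    becomes a weighted integral. *)
Lemma Rintegral_expV2 (R : realType) (a b : R) : 0 < a -> a < b ->
  \int[lebesgue_measure]_(u in `[a, b]) (u ^- 2) = a^-1 - b^-1.
Proof.
move=> a0 ab; have u0 (u : R) : u \in `[a, b] -> u != 0.
  by rewrite in_itv/= => /andP[au _]; rewrite gt_eqF// (lt_le_trans a0).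
have DV (u : R) : u \in `[a, b] -> is_derive u 1 (fun u : R => - u^-1) (u ^- 2).
  move=> uab; have D := @is_deriveV R id u _ _ (u0 u uab) (is_derive_id u 1).
  apply: (is_derive_eq (is_deriveN D)).
  by rewrite /GRing.scale/= mulr1 opprK.
have c2 : {within `[a, b], continuous (fun u : R => u ^- 2)}.
  apply: derivable_within_continuous => u /u0 un0; apply: derivableV.
    by rewrite expf_neq0.
  exact: exprn_derivable.
have cV : {within `[a, b], continuous (fun u : R => - u^-1)}.
  by apply: derivable_within_continuous => u /DV[].
have DV' (u : R) : u \in `]a, b[ ->
    is_derive u 1 (fun u : R => - u^-1) (u ^- 2).
  by move=> uab; apply: DV; exact: subset_itv_oo_cc uab.
have -> := Rintegral_FTC2 R _ _ a b ab c2 cV DV'.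
by rewrite opprK addrC.
Qed.

Theorem theorem7 (R : realType) (s : R) (I : set R) (f : R -> R)
    (a b p q : R)
    (hs : 0 < s <= 1)
    (Iitv : is_interval I)
    (Ipos : forall u, I u -> 0 < u)
    (f_diff : forall u, I° u -> derivable f u 1)
    (Ia : I a) (Ib : I b) (ab : a < b)
    (f_diff_ab : forall u, a <= u <= b -> derivable1_within I f u)
    (f'_L1 : lebesgue_measure.-integrable `[a, b]
               (EFin \o derive1_within I f))
    (hq : 1 < q) (hpq : 1 / p + 1 / q = 1)
    (f'_conv : harmonically_s_convex s `[a, b]
                 (fun u => `|derive1_within I f u| `^ q))
    (x : R) (hx : a <= x <= b) :
  `|f x - a * b / (b - a) *
      \int[lebesgue_measure]_(u in `[a, b]) (f u / u ^+ 2)|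
  <= a * b / (b - a) * (1 / (p + 1)) `^ (1 / p) *
     ((x - a) ^+ 2 *
        (lambda1 a x s q 0 * `|derive1_within I f x| `^ q
         + lambda2 a x s q 0 * `|derive1_within I f a| `^ q) `^ (1 / q)
      + (b - x) ^+ 2 *
        (lambda3 b x s q 0 * `|derive1_within I f x| `^ q
         + lambda4 b x s q 0 * `|derive1_within I f b| `^ q) `^ (1 / q)).
Proof.
have a0 := Ipos _ Ia; have b0 := Ipos _ Ib; have /andP[s0 _] := hs.
have /andP[ax xb] := hx; have x0 := lt_le_trans a0 ax.
have q0 : 0 < q by exact: lt_trans hq.
move: hpq; rewrite !div1r => pq.
(* Since [p^-1 = 1 - q^-1 > 0]; this also rules out [p = 0], whose inverse is [0] by convention. *)
have p0 : 0 < p.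
  have q1 : q^-1 < 1 by rewrite invf_lt1.
  by rewrite -invr_gt0; lra.
rewrite (lambda1E R a x s q a0 x0 s0) (lambda2E R a x s q a0 x0 s0).
rewrite (lambda3E R b x s q b0 x0 s0) (lambda4E R b x s q b0 x0 s0).
move: f'_conv; set df := derive1_within I f => cvx.
have Iab (u : R) : a <= u <= b -> I u by exact: Iitv.
have cf : {within `[a, b], continuous f}.
  apply/subspace_continuousP => u /=; rewrite in_itv/= => uab.
  apply: cvg_trans (derivable1_within_continuous _ _ _ _ (f_diff_ab _ uab)).
  apply: cvg_app => U IU.
  have {}IU : \forall y \near u, I y -> U y by [].
  suff : \forall y \near u, y \in `[a, b] -> U y by [].
  by apply: filterS IU => y IU; rewrite in_itv/= => yab; exact/IU/Iab.
(* A point strictly between [a] and [b] is interior to [I], where the relative derivative is the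
   ordinary one. *)
have Df (u : R) : u \in `]a, b[ -> is_derive u 1 f (df u).
  move=> uab; have Iu : I° u.
    have : nbhs u `]a, b[%classic.
      by apply: open_nbhs_nbhs; split=> //; exact: interval_open.
    apply: filterS => y /=; rewrite in_itv/= => /andP[ay yb].
    by apply: Iab; rewrite !ltW.
  split; first exact: f_diff.
  by rewrite /df (derive1_within_interior _ Iu) derive1E.
have c2 : {within `[a, b], continuous (fun u : R => u ^- 2)}.
  apply: derivable_within_continuous => u; rewrite in_itv/= => /andP[au _].
  apply: derivableV; last exact: exprn_derivable.
  by rewrite expf_neq0// gt_eqF// (lt_le_trans a0).
have cB : {within `[a, b], continuous (fun u => f x - f u)}.
  by move=> u; apply: cvgB; [exact: cvg_cst|exact: cf].
have cF := within_continuousM _ _ _ _ cB c2.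
have cH := primitive_continuous _ _ _ _ (ltW ab) cF.
have DH := fun t => primitive_is_derive _ _ _ _ t cF.
have Ha : \int[lebesgue_measure]_(w in `[a, a]) ((f x - f w) * w ^- 2) = 0.
  by rewrite set_itv1 Rintegral_set1.
have Hb : \int[lebesgue_measure]_(w in `[a, b]) ((f x - f w) * w ^- 2) =
    f x * (a^-1 - b^-1) -
    \int[lebesgue_measure]_(u in `[a, b]) (f u / u ^+ 2).
  have cx : {within `[a, b], continuous (fun u : R => f x * u ^- 2)}.
    apply: within_continuousM => //.
    by apply: continuous_subspaceT => t; exact: cvg_cst.
  have cfu : {within `[a, b], continuous (fun u : R => f u * u ^- 2)}.
    exact: within_continuousM.
  have eZ : \int[lebesgue_measure]_(u in `[a, b]) (f x * u ^- 2) =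
      f x * \int[lebesgue_measure]_(u in `[a, b]) (u ^- 2).
    by rewrite RintegralZl//; exact: continuous_itv_integrable.
  transitivity (\int[lebesgue_measure]_(u in `[a, b])
      (f x * u ^- 2 - f u * u ^- 2)).
    by apply: eq_Rintegral => u _; rewrite mulrBl.
  rewrite RintegralB//; last 2 first.
  - exact: continuous_itv_integrable.
  - exact: continuous_itv_integrable.
  by rewrite eZ Rintegral_expV2.
move: Ha Hb cH DH.
set H := fun u : R =>
  \int[lebesgue_measure]_(w in `[a, u]) ((f x - f w) * w ^- 2).
(* From here on only the continuity and derivative of [H] and its values at [a] and [b] are used. *)
rewrite -/(H a) -/(H b); clearbody H => Ha Hb cH DH.
pose C := (p + 1)^-1 `^ p^-1; have C0 : 0 <= C by exact: powR_ge0.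
have xab : x \in `[a, b] by rewrite in_itv/= ax xb.
have half (e : R) : e \in `[a, b] -> `|H x - H e| <= (x - e) ^+ 2 * (C *
    (weight1 e x s (2 * q) * `|df x| `^ q +
     weight2 e x s (2 * q) * `|df e| `^ q) `^ q^-1).
  (* When [x] coincides with the endpoint [e], the left-hand side is [0]. *)
  move=> eab; have [->|ex] := eqVneq e x.
    by rewrite subrr normr0 mulr_ge0 ?sqr_ge0// mulr_ge0 ?powR_ge0.
  apply: (half_bound R f df H a b e x s p q a0 ab eab xab ex s0 p0 q0 pq cf cH
    Df DH) => t; rewrite in_itv/= => /andP[t0 t1].
  by apply: cvx => //; rewrite !ltW.
have ha := half a; have hb := half b.
have -> : f x - a * b / (b - a) *
    \int[lebesgue_measure]_(u in `[a, b]) (f u / u ^+ 2) =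
    a * b / (b - a) * ((H x - H a) - (H x - H b)).
  rewrite Hb Ha; field.
  by rewrite subr_eq0 !gt_eqF.
have k0 : 0 <= a * b / (b - a).
  by rewrite mulr_ge0 ?invr_ge0 ?subr_ge0 ?mulr_ge0// ltW.
rewrite normrM (ger0_norm k0) -[leRHS]mulrA ler_wpM2l// mulrDr.
apply: le_trans (ler_normB _ _) _; apply: lerD.
  rewrite mulrCA; apply: ha.
  by rewrite in_itv/= lexx ltW.
rewrite mulrCA -[(b - x) ^+ 2]sqrrN opprB; apply: hb.
by rewrite in_itv/= lexx andbT ltW.
Qed.
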